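(* Let $X^m$ be an $m$-dimensional real analytic DC-manifold, let $N^n$ be a real analytic manifold of dimension $n>m$, and let $f:X^m\to N^n$ be a (real analytic) DC-immersion which is $C^\omega$-arc-proper as a continuous map. Then $f(X^m)$ is an analytically complete subset of $N^n$. In particular, if $f$ is a proper map, then $f(X^m)$ is analytically complete.
   Context: DC-manifolds. Let $m\ge 2$. The standard double-cone is $\mathcal C^m_2=\{(x_1,\dots,x_{m+1})\in\mathbf R^{m+1} : \sum_{j=1}^m x_j^2=x_{m+1}^2\}$, and $\pi^m:S^{m-1}\times\mathbf R\to\mathcal C^m_2$ is $\pi^m(\mathbf x,t)=(t\mathbf x,t)$, where $S^{m-1}\subset\mathbf R^m$ is the unit sphere. A topological DC-manifold of dimension $m$ is a second countable Hausdorff space $X$ each point of which has a neighborhood homeomorphic to an open subset of $\mathcal C^m_2$; a point corresponding to the origin is called a DC-point. If $\hat U\subset\mathcal C^m_2$ is open and $\varphi:\hat U\to O$ is a homeomorphism onto a connected open set $O\subset X$, put $U=(\pi^m)^{-1}(\hat U)$ and $\Phi=\varphi\circ\pi^m|_U$; the pair $(U,\Phi)$ is an inverse DC-coordinate system and $(O,\varphi^{-1})$ is the associated local DC-coordinate system. A real analytic DC-structure on $X$ is a collection $\{(U_\lambda,\Phi_\lambda)\}$ of inverse DC-coordinate systems such that the sets $O_\lambda=\Phi_\lambda(U_\lambda)$ cover $X$; whenever $O_\lambda\cap O_\mu\neq\varnothing$ there is a real analytic diffeomorphism $\Phi_{\mu\lambda}:\Phi_\lambda^{-1}(O_\mu)\to\Phi_\mu^{-1}(O_\lambda)$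 with $\Phi_\mu\circ\Phi_{\mu\lambda}=\Phi_\lambda$; and the collection is maximal with this property. A real analytic DC-manifold is a topological DC-manifold with such a structure. DC-immersions. A map $f:X^m\to N^n$ ($n>m$) into a real analytic manifold is a (real analytic) DC-immersion if for each $p\in X^m$ there exist a local DC-coordinate system $(O,\psi)$ (belonging to the DC-structure) with $p\in O$ and a real analytic diffeomorphism $F$ from a neighborhood $\Omega_0$ of the origin of $\mathbf R^n$ onto a neighborhood of $f(p)$ such that $\psi(O)\times\{\mathbf 0_{n-m-1}\}\subset\Omega_0$ and $F(a,\mathbf 0_{n-m-1})=f\circ\psi^{-1}(a)$ for all $a\in\psi(O)\subset\mathcal C^m_2$, where $\mathbf 0_{n-m-1}$ is the zero vector of $\mathbf R^{n-m-1}$. Arc-properness. Let $X$ be a locally compact, second countable Hausdorff space and $f:X\to N^n$ continuous. A continuous map $\sigma:[0,1)\to X$ is $(C^\omega,f)$-extendable if $f\circ\sigma$ extends to a real analytic map defined on $[0,1]$. The map $f$ is $C^\omega$-arc-proper if for each $(C^\omega,f)$-extendable continuous map $\sigma:[0,1)\to X$ there is a sequence $\{t_k\}$ in $[0,1)$ converging to $1$ such that $\lim_{k\to\infty}\sigma(t_k)$ exists in $X$. Analytic completeness. A non-empty subset $S\subset N^n$ is analytically complete if every real analytic map $\Gamma:[0,1]\to N^n$ with $\Gamma([0,\varepsilon))\subset S$ for some $\varepsilon\in(0,1)$ satisfies $\Gamma([0,1])\subset S$. *)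

(* Defs.v *)
From HB Require Import structures.
From mathcomp Require Import all_boot all_order all_algebra.
From mathcomp Require Import all_classical all_reals all_analysis.

Set Implicit Arguments.
Unset Strict Implicit.
Unset Printing Implicit Defensive.
Import Order.TTheory GRing.Theory Num.Theory.
Import numFieldNormedType.Exports.
Local Open Scope classical_set_scope.
Local Open Scope ring_scope.

(* A homeomorphism between subsets of S and T (with the subspace topologies).
   The two maps are total functions whose values off [src], [tgt] are
   irrelevant. *)
Record partial_homeo (S T : topologicalType) := PartialHomeo {
  src : set S;
  tgt : set T;
  fwd : S -> T;
  bwd : T -> S;
  fwd_tgt : forall x, src x -> tgt (fwd x);
  bwd_src : forall y, tgt y -> src (bwd y);
  fwdK : forall x, src x -> bwd (fwd x) = x;
  bwdK : forall y, tgt y -> fwd (bwd y) = y;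
  fwd_continuous : {within src, continuous fwd};
  bwd_continuous : {within tgt, continuous bwd}
}.

Section RealAnalytic.
Variable R : realType.

Definition mterm k (c : {ffun 'I_k -> nat} -> R) (h : 'rV[R]_k)
    (alpha : {ffun 'I_k -> nat}) : R :=
  c alpha * \prod_i h 0 i ^+ alpha i.

(* Sum of [F] over the multi-indices all of whose entries are < d. *)
Definition box_sum k (F : {ffun 'I_k -> nat} -> R) (d : nat) : R :=
  \sum_(alpha : {ffun 'I_k -> 'I_d}) F [ffun i => nat_of_ord (alpha i)].

(* Near [a], each component of [g] is the sum of an absolutely convergent
   power series in x - a; absolute convergence makes the order of summation
   (here along boxes) irrelevant. *)
Definition analytic_at k l (g : 'rV[R]_k -> 'rV[R]_l) (a : 'rV[R]_k) : Prop :=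
  forall j : 'I_l, exists c : {ffun 'I_k -> nat} -> R,
    \forall x \near a,
      cvgn (box_sum (fun alpha => `|mterm c (x - a) alpha|)) /\
      box_sum (mterm c (x - a)) @ \oo --> g x 0 j.

(* On a subset A of R^k that need not be open (an interval with end points,
   an open subset of S^(m-1) x R), analytic means: locally the restriction to A
   of an analytic map of the ambient space. *)
Definition analytic_within k l (A : set 'rV[R]_k) (g : 'rV[R]_k -> 'rV[R]_l)
    (a : 'rV[R]_k) : Prop :=
  exists2 e : 'rV[R]_k -> 'rV[R]_l,
    analytic_at e a & \forall x \near a, A x -> g x = e x.

Definition analytic_on k l (A : set 'rV[R]_k) (g : 'rV[R]_k -> 'rV[R]_l) :
    Prop :=
  forall a, A a -> analytic_within A g a.

Definition analytic_diffeo k l (A : set 'rV[R]_k) (B : set 'rV[R]_l)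
    (g : 'rV[R]_k -> 'rV[R]_l) : Prop :=
  exists h : 'rV[R]_l -> 'rV[R]_k,
    [/\ forall x, A x -> B (g x) /\ h (g x) = x,
        forall y, B y -> A (h y) /\ g (h y) = y,
        analytic_on A g & analytic_on B h].

(* A chart of N is given by its parametrization [fwd],
   from an open subset of R^n onto an open subset of N. *)
Section Manifold.
Variables (n : nat) (N : topologicalType).
Implicit Type A : set (partial_homeo 'rV[R]_n N).

Definition analytic_atlas A : Prop :=
  [/\ forall c, A c -> open (src c) /\ open (tgt c),
      forall y, exists2 c, A c & tgt c y &
      forall c d, A c -> A d ->
        analytic_on (src c `&` fwd c @^-1` tgt d) (bwd d \o fwd c)].

Definition analytic_manifold A : Prop :=
  [/\ hausdorff_space N, @second_countable N, analytic_atlas A &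
      forall A', analytic_atlas A' -> A `<=` A' -> A' `<=` A].

Definition analytic_into A k (D : set 'rV[R]_k) (g : 'rV[R]_k -> N) : Prop :=
  forall a, D a -> exists2 c, A c &
    (\forall x \near a, D x -> tgt c (g x)) /\ analytic_within D (bwd c \o g) a.

Definition analytic_from A k (V : set N) (h : N -> 'rV[R]_k) : Prop :=
  forall y, V y -> exists2 c, A c &
    tgt c y /\
    analytic_within (src c `&` fwd c @^-1` V) (h \o fwd c) (bwd c y).

Definition unit_interval : set 'rV[R]_1 := [set x | 0 <= x 0 0 <= 1].

(* [Gamma] is real analytic on [0, 1], viewed as a subset of R^1. *)
Definition analytic_curve A (Gamma : R -> N) : Prop :=
  analytic_into A unit_interval (fun x => Gamma (x 0 0)).

Definition analytically_complete A (S : set N) : Prop :=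
  S !=set0 /\
  forall Gamma : R -> N, analytic_curve A Gamma ->
    (exists2 eps : R, 0 < eps < 1 & forall t, 0 <= t < eps -> S (Gamma t)) ->
    forall t, 0 <= t <= 1 -> S (Gamma t).

Definition extendable A (X : topologicalType) (f : X -> N) (sigma : R -> X) :
    Prop :=
  exists2 Gamma : R -> N, analytic_curve A Gamma &
    forall t, 0 <= t < 1 -> Gamma t = f (sigma t).

Definition arc_proper A (X : topologicalType) (f : X -> N) : Prop :=
  forall sigma : R -> X,
    {within [set t : R | 0 <= t < 1], continuous sigma} ->
    extendable A f sigma ->
    exists t : nat -> R,
      [/\ forall k, 0 <= t k < 1, t @ \oo --> (1 : R) &
          exists p : X, (sigma \o t) @ \oo --> p].

End Manifold.

Definition proper_map (X Y : topologicalType) (f : X -> Y) : Prop :=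
  forall K : set Y, compact K -> compact (f @^-1` K).

(* Points of R^(m+1) = R^m x R are row vectors of size m + 1; [lsubmx] and
   [rsubmx] are the two projections. *)
Section DCManifold.
Variable m : nat.

Definition double_cone : set 'rV[R]_(m + 1) :=
  [set x | \sum_j (lsubmx x 0 j) ^+ 2 = (rsubmx x 0 0) ^+ 2].

(* S^(m-1) x R, as a submanifold of R^m x R. *)
Definition sphere_line : set 'rV[R]_(m + 1) :=
  [set z | \sum_j (lsubmx z 0 j) ^+ 2 = 1].

Definition cone_proj (z : 'rV[R]_(m + 1)) : 'rV[R]_(m + 1) :=
  row_mx (rsubmx z 0 0 *: lsubmx z) (rsubmx z).

Definition open_in_cone (U : set 'rV[R]_(m + 1)) : Prop :=
  exists2 W, open W & U = W `&` double_cone.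

Variable X : topologicalType.

Definition topological_DC_manifold : Prop :=
  [/\ @second_countable X, hausdorff_space X &
      forall p : X, exists2 c : partial_homeo 'rV[R]_(m + 1) X,
        open_in_cone (src c) & nbhs p (tgt c)].

(* [fwd c] is phi : \hat U -> O, and [bwd c] is the local DC-coordinate map
   psi = phi^-1 on O. *)
Definition DC_coord (c : partial_homeo 'rV[R]_(m + 1) X) : Prop :=
  [/\ open_in_cone (src c), open (tgt c) & connected (tgt c)].

(* The inverse DC-coordinate system (U, Phi) determined by [c]; its image
   Phi(U) is [tgt c]. *)
Definition inv_dom (c : partial_homeo 'rV[R]_(m + 1) X) :
    set 'rV[R]_(m + 1) :=
  sphere_line `&` cone_proj @^-1` src c.

Definition inv_map (c : partial_homeo 'rV[R]_(m + 1) X) :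
    'rV[R]_(m + 1) -> X :=
  fwd c \o cone_proj.

Definition DC_compatible (c d : partial_homeo 'rV[R]_(m + 1) X) : Prop :=
  tgt c `&` tgt d !=set0 ->
  exists2 g : 'rV[R]_(m + 1) -> 'rV[R]_(m + 1),
    analytic_diffeo (inv_dom c `&` inv_map c @^-1` tgt d)
                    (inv_dom d `&` inv_map d @^-1` tgt c) g &
    forall z, inv_dom c z -> tgt d (inv_map c z) ->
      inv_map d (g z) = inv_map c z.

Definition DC_atlas (D : set (partial_homeo 'rV[R]_(m + 1) X)) : Prop :=
  [/\ forall c, D c -> DC_coord c,
      forall p, exists2 c, D c & tgt c p &
      forall c d, D c -> D d -> DC_compatible c d].

Definition analytic_DC_manifold (D : set (partial_homeo 'rV[R]_(m + 1) X)) :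
    Prop :=
  [/\ topological_DC_manifold, DC_atlas D &
      forall D', DC_atlas D' -> D `<=` D' -> D' `<=` D].

(* a |-> (a, 0) from R^k to R^n, for k <= n. *)
Definition pad0 k n (a : 'rV[R]_k) : 'rV[R]_n :=
  \row_(j < n) (if insub (nat_of_ord j) is Some i then a 0 i else 0).

(* [c] is the coordinate system (O, psi); [F] is a real analytic
   diffeomorphism from the open neighborhood [src F] of the origin onto the
   open neighborhood [tgt F] of f p. *)
Definition DC_immersion (D : set (partial_homeo 'rV[R]_(m + 1) X))
    n (N : topologicalType) (A : set (partial_homeo 'rV[R]_n N)) (f : X -> N) :
    Prop :=
  forall p : X, exists c : partial_homeo 'rV[R]_(m + 1) X,
    [/\ D c, tgt c p &
      exists F : partial_homeo 'rV[R]_n N,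
        [/\ open (src F) /\ src F 0,
            open (tgt F) /\ tgt F (f p),
            analytic_into A (src F) (fwd F),
            analytic_from A (tgt F) (bwd F) &
            forall a, src c a ->
              src F (pad0 n a) /\ fwd F (pad0 n a) = f (fwd c a)]].

End DCManifold.
End RealAnalytic.

(* Main.v *)
(* Choose, for each t in (0, eps), a point q t over Gamma t. The uncountable set
   of pairs (t, q t) sits in a second countable space, so it accumulates at one
   of its points (t0, q t0). In the straightening coordinates of f at q t0, the
   equations of the cone and of R^(m+1) x 0 are analytic functions of the
   parameter of Gamma that vanish at parameters accumulating at t0, hence vanish
   near t0, and Gamma lifts to X near t0. Lifts are unique because f is
   locally injective, so there is a maximal lift to the right of t0, up to some
   T. Arc-properness provides a limit point of the lift over Gamma T, and if
   T < 1 the same vanishing argument at T extends the lift beyond T. *)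

Require Import Defs.
From HB Require Import structures.
From mathcomp Require Import all_boot all_order all_algebra.
From mathcomp Require Import all_classical all_reals all_analysis.
From mathcomp Require Import ring lra.
Import Order.TTheory GRing.Theory Num.Theory.
Import numFieldNormedType.Exports.
Local Open Scope classical_set_scope.
Local Open Scope ring_scope.
Set Implicit Arguments.
Unset Strict Implicit.
Unset Printing Implicit Defensive.

(** * Analytic germs of one-variable functions *)

Section Jets.
Variable R : realType.
Implicit Types (r M : R) (h g : R -> R).

(* [jet r p M h]: on |t| < r, h is a polynomial with coefficients c_i, i < p,
   plus a remainder bounded by s * (|t| / r) ^ p, with
   \sum_(i < p) |c_i| * r ^ i + s <= M. A function with such expansions for all
   p and one M is analytic, and the best M is a submultiplicative norm. *)
Fixpoint jet r p M h : Prop :=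
  if p is p'.+1 then
    exists c g M', [/\ forall t, `|t| < r -> h t = c + t * g t,
      jet r p' M' g & `|c| + r * M' <= M]
  else forall t, `|t| < r -> `|h t| <= M.

Lemma jet_ge0 r p M h : 0 < r -> jet r p M h -> 0 <= M.
Proof.
move=> r0; elim: p M h => [|p IH] M h /=.
  by move=> /(_ 0); rewrite normr0 => /(_ r0); apply: le_trans.
move=> [c [g [M' [_ /IH M'0]]]]; apply: le_trans.
by rewrite addr_ge0 // mulr_ge0 // ltW.
Qed.

Lemma jet_le r p M M' h : M <= M' -> jet r p M h -> jet r p M' h.
Proof.
case: p => [|p] /= MM'; first by move=> H t /H /le_trans; apply.
by move=> [c [g [M1 [? ? /le_trans H]]]]; exists c, g, M1; split=> //; apply: H.
Qed.

Lemma jet_ext r p M h g :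
  (forall t, `|t| < r -> h t = g t) -> jet r p M h -> jet r p M g.
Proof.
case: p => [|p] /= hg; first by move=> H t tr; rewrite -hg //; apply: H.
move=> [c [g' [M1 [H ? ?]]]]; exists c, g', M1; split=> // t tr.
by rewrite -hg // H.
Qed.

Lemma jet_bound r p M h t : 0 < r -> jet r p M h -> `|t| < r -> `|h t| <= M.
Proof.
move=> r0; elim: p M h => [|p IH] M h /=; first by apply.
move=> [c [g [M' [hE jg le]]]] tr; rewrite hE // (le_trans _ le) //.
rewrite (le_trans (ler_normD _ _)) // lerD2l normrM.
by apply: ler_pM => //; [exact: ltW | exact: IH].
Qed.

Lemma jet_pred r p M h : 0 < r -> jet r p.+1 M h -> jet r p M h.
Proof.
move=> r0; elim: p M h => [|p IH] M h jh.
  by move=> t; apply: jet_bound jh.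
by case: jh => c [g [M' [? /IH ? ?]]]; exists c, g, M'.
Qed.

Lemma jet_cst r p c : jet r p `|c| (fun=> c).
Proof.
elim: p c => [|p IH] c //=; exists c, (fun=> 0), `|0 : R|; split=> //.
  by move=> t _; rewrite mulr0 addr0.
by rewrite normr0 mulr0 addr0.
Qed.

Lemma jet_id r p : jet r p r id.
Proof.
case: p => [|p] /=; first by move=> t /ltW.
exists 0, (fun=> 1), `|1 : R|; split; last by rewrite normr0 normr1 mulr1 add0r.
  by move=> t _; rewrite mulr1 add0r.
exact: jet_cst.
Qed.

Lemma jet_add r p M1 M2 h1 h2 :
  jet r p M1 h1 -> jet r p M2 h2 -> jet r p (M1 + M2) (fun t => h1 t + h2 t).
Proof.
elim: p M1 M2 h1 h2 => [|p IH] M1 M2 h1 h2 /=.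
  move=> H1 H2 t tr; rewrite (le_trans (ler_normD _ _)) // lerD ?H1 ?H2 //.
move=> [c1 [g1 [M1' [E1 j1 le1]]]] [c2 [g2 [M2' [E2 j2 le2]]]].
exists (c1 + c2), (fun t => g1 t + g2 t), (M1' + M2'); split; last 2 first.
- exact: IH.
- have := ler_normD c1 c2; nra.
- by move=> t tr; rewrite E1 // E2 //; ring.
Qed.

(** Writing [hi = ci + t * gi], the product is [c1 * c2 + t * (c1 * g2 + g1 * h2)]. Leaving [h2]
    undivided (hence the use of [jet_pred]) makes the norms fit: [|c1| |c2| + r (|c1| M2' + M1' M2)
    <= |c1| M2 + r M1' M2 <= M1 M2]. *)
Lemma jet_mul r p M1 M2 h1 h2 : 0 < r ->
  jet r p M1 h1 -> jet r p M2 h2 -> jet r p (M1 * M2) (fun t => h1 t * h2 t).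
Proof.
move=> r0; elim: p M1 M2 h1 h2 => [|p IH] M1 M2 h1 h2.
  by move=> H1 H2 t tr; rewrite normrM ler_pM // ?H1 ?H2.
move=> j1 j2; have j2p := jet_pred r0 j2; have M20 := jet_ge0 r0 j2.
case: j1 j2 => [c1 [g1 [M1' [E1 j1 le1]]]] [c2 [g2 [M2' [E2 j2 le2]]]].
exists (c1 * c2), (fun t => c1 * g2 t + g1 t * h2 t), (`|c1| * M2' + M1' * M2).
split.
- by move=> t tr; rewrite E1 // E2 //; ring.
- by apply: jet_add; apply: IH => //; apply: jet_cst.
- rewrite normrM.
  apply: (le_trans _ (ler_wpM2r M20 le1)).
  have := ler_wpM2l (normr_ge0 c1) le2; lra.
Qed.

Lemma jet_exp r p M h n : 0 < r ->
  jet r p M h -> jet r p (M ^+ n) (fun t => h t ^+ n).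
Proof.
move=> r0 jh; elim: n => [|n IH].
  by rewrite expr0 -[X in jet _ _ X](normr1 R); exact: jet_cst.
rewrite exprS; apply: jet_ext (jet_mul r0 jh IH) => t _.
by rewrite exprS.
Qed.

Lemma jet_sum r p (I : Type) (s : seq I) (M : I -> R) (h : I -> R -> R) :
  (forall i, jet r p (M i) (h i)) ->
  jet r p (\sum_(i <- s) M i) (fun t => \sum_(i <- s) h i t).
Proof.
move=> jh; elim: s => [|i s IH].
  rewrite big_nil -[X in jet _ _ X](normr0 R).
  by apply: jet_ext (jet_cst _ _ _) => t _; rewrite big_nil.
rewrite big_cons; apply: jet_ext (jet_add (jh i) IH) => t _.
by rewrite big_cons.
Qed.

Lemma jet_prod r p (I : Type) (s : seq I) (M : I -> R) (h : I -> R -> R) :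
  0 < r -> (forall i, jet r p (M i) (h i)) ->
  jet r p (\prod_(i <- s) M i) (fun t => \prod_(i <- s) h i t).
Proof.
move=> r0 jh; elim: s => [|i s IH].
  rewrite big_nil -[X in jet _ _ X](normr1 R).
  by apply: jet_ext (jet_cst _ _ _) => t _; rewrite big_nil.
rewrite big_cons; apply: jet_ext (jet_mul r0 (jh i) IH) => t _.
by rewrite big_cons.
Qed.

Lemma jet_shrink r r' p M h : 0 < r' -> r' <= r -> jet r p M h -> jet r' p M h.
Proof.
move=> r'0 r'r; elim: p M h => [|p IH] M h /=.
  by move=> H t tr; apply: H; apply: lt_le_trans tr r'r.
move=> [c [g [M' [E j le]]]]; exists c, g, M'; split.
- by move=> t tr; apply: E; apply: lt_le_trans tr r'r.
- exact: IH.
- have := jet_ge0 (lt_le_trans r'0 r'r) j; nra.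
Qed.

(** A Schwarz-type estimate: as [h 0 = 0], [h] is [t] times a function of norm at most [M / r], and
    [t] has norm [r'] on the smaller disc. The norm can thus be made as small as desired by
    shrinking the radius. *)
Lemma jet_small r r' M h : 0 < r' -> r' <= r -> h 0 = 0 ->
  (forall p, jet r p M h) -> forall p, jet r' p (r' / r * M) h.
Proof.
move=> r'0 r'r h0 jh p.
have r0 := lt_le_trans r'0 r'r.
have [c [g [M' [E jg le]]]] := jh p.+1.
have c0 : c = 0 by have := E 0; rewrite normr0 h0 mul0r addr0 => /(_ r0).
have /(jet_le (M' := r' / r * M)) : r' * M' <= r' / r * M.
  rewrite -mulrA ler_pM2l // mulrC ler_pdivlMr //.
  by move: le; rewrite c0 normr0 add0r mulrC.
have jtg := jet_mul r'0 (jet_id _ p) (jet_shrink r'0 r'r jg).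
apply; apply: jet_ext jtg => t tr.
by rewrite E ?c0 ?add0r // (lt_le_trans tr).
Qed.

(** The identity theorem. Zeros accumulating at 0 kill the constant coefficient, and the quotient by
    [t] has the same nonzero zeros; by induction [|h t| <= M * (|t| / r) ^ p] for every [p], and the
    right side tends to 0. *)
Lemma jet_vanish r M h : 0 < r -> (forall p, jet r p M h) ->
  (forall d, 0 < d -> exists2 t, 0 < `|t| < d & h t = 0) ->
  forall t, `|t| < r -> h t = 0.
Proof.
move=> r0 jh zh.
have main p : forall M h, jet r p M h ->
    (forall d, 0 < d -> exists2 t, 0 < `|t| < d & h t = 0) ->
    forall t, `|t| < r -> `|h t| <= M * (`|t| / r) ^+ p.
  elim: p => [|p IH] {jh zh}M {}h.
    by move=> H _ t tr; rewrite expr0 mulr1; apply: H.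
  move=> [c [g [M' [E j le]]]] zh.
  have M'0 := jet_ge0 r0 j.
  have c0 : c = 0.
    apply/eqP; rewrite -normr_le0; apply/ler_addgt0Pr => e e0; rewrite add0r.
    (* Adding 1 keeps the denominator positive when [M' = 0]. *)
    have d0 : 0 < Num.min r (e / (M' + 1)).
      by rewrite lt_min r0 divr_gt0 // ltr_wpDl.
    have [t /andP[t0]] := zh _ d0; rewrite lt_min => /andP[tr te] ht.
    have /eqP := E t tr; rewrite ht eq_sym addr_eq0 => /eqP ->.
    rewrite normrN normrM.
    have := jet_bound r0 j tr.
    move: te; rewrite ltr_pdivlMr ?ltr_wpDl // => te.
    have := normr_ge0 (g t); nra.
  have zg d : 0 < d -> exists2 t, 0 < `|t| < d & g t = 0.
    move=> d0; have d1 : 0 < Num.min r d by rewrite lt_min r0.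
    have [t /andP[t0]] := zh _ d1; rewrite lt_min => /andP[tr td] ht.
    exists t; first by rewrite t0.
    have /esym/eqP := E t tr; rewrite ht c0 add0r mulf_eq0.
    by rewrite -[t == 0]normr_eq0 gt_eqF //= => /eqP.
  move=> t tr; rewrite E // c0 add0r normrM.
  have := IH _ _ j zg t tr; move: le; rewrite c0 normr0 add0r exprS => le gt.
  apply: le_trans (ler_wpM2l (normr_ge0 t) gt) _.
  rewrite [X in _ <= X](_ : _ = `|t| * (M / r * (`|t| / r) ^+ p)); last by ring.
  apply: ler_wpM2l => //; apply: ler_wpM2r.
    by rewrite exprn_ge0 // divr_ge0 // ltW.
  by rewrite ler_pdivlMr // mulrC.
move=> t tr; apply/eqP; rewrite -normr_le0.
have lim0 : (fun p => M * (`|t| / r) ^+ p) @ \oo --> M * 0.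
  apply: cvgM; first exact: cvg_cst.
  apply: cvg_expr; rewrite ger0_norm ?divr_ge0 ?ltr_pdivrMr ?mul1r // ltW //.
rewrite mulr0 in lim0.
apply: (ler_cvg_to (a := \oo) (f := fun=> `|h t|) _ lim0).
  exact: cvg_cst.
by near=> p; apply: main.
Unshelve. all: end_near. Qed.

Lemma bounded_ultra_cvg (U : set_system nat) (x : nat -> R) (K : R) :
  UltraFilter U -> (forall N, `|x N| <= K) -> exists l : R, x @ U --> l.
Proof.
move=> UU xK; have PU : ProperFilter U := @ultra_proper _ _ UU.
have [|l [_ cl]] := @segment_compact R (- K) K (x @ U).

  by apply: (@filterE _ U) => N; rewrite /= in_itv /= -ler_norml.
exists l => V Vl.
have [//|UV] := in_ultra_setVsetC (x @^-1` V) UU.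
by have [y [/= + Vy]] := cl (~` V) V UV Vl.
Qed.

(** The leading coefficients, the norms of the remainders and the remainders at every [t] are
    bounded, so all converge along [U]. An ultrafilter serves here because uncountably many values
    must converge at once, which no diagonal extraction provides. *)
Lemma jet_lim (U : set_system nat) r p (K M : R) (M_ : nat -> R)
    (h_ : nat -> R -> R) h :
  UltraFilter U -> 0 < r -> (forall N, jet r p (M_ N) (h_ N)) ->
  (forall N, M_ N <= K) -> M_ @ U --> M ->
  (forall t, `|t| < r -> h_ ^~ t @ U --> h t) -> jet r p M h.
Proof.
move=> UU r0; have PU : ProperFilter U := @ultra_proper _ _ UU.
elim: p K M M_ h_ h => [|p IH] K M M_ h_ h jh MK Ml hl.
  move=> t tr; apply: (ler_cvg_to (a := U) (cvg_norm (hl t tr)) Ml).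
  by apply: filterE => N; apply: jh.
have [c_ /choice[g_ /choice[M1_ jc]]] := choice jh.
have M10 N : 0 <= M1_ N by have [_ /(jet_ge0 r0)] := jc N.
have cK N : `|c_ N| <= K.
  by have [_ _ le] := jc N; have := MK N; have := M10 N; nra.
have M1K N : M1_ N <= K / r.
  rewrite ler_pdivlMr // mulrC.
  by have [_ _ le] := jc N; have := MK N; have := normr_ge0 (c_ N); lra.
have [c cl] := bounded_ultra_cvg UU cK.
have /(bounded_ultra_cvg UU)[M1 M1l] : forall N, `|M1_ N| <= K / r.
  by move=> N; rewrite ger0_norm.
have /choice[g gl] (t : R) : exists l : R, `|t| < r -> g_ ^~ t @ U --> l.
  have [tr|_] := boolP (`|t| < r); last by exists 0.
  have /(bounded_ultra_cvg UU)[l ll] : forall N, `|g_ N t| <= K / r.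
    move=> N; have [_ jg _] := jc N.
    exact: le_trans (jet_bound r0 jg tr) (M1K N).
  by exists l.
exists c, g, M1; split.
- move=> t tr.
  apply: (cvg_unique (@norm_hausdorff _ R) (hl t tr)).
  have : (fun N => c_ N + t * g_ N t) @ U --> c + t * g t.
    by apply: cvgD => //; apply: cvgM; [exact: cvg_cst | exact: gl].
  apply: cvg_trans; apply: near_eq_cvg; apply: filterE => N.
  by have [-> //] := jc N.
- by apply: (IH (K / r) M1 M1_ g_) => // N; have [] := jc N.
- apply: (ler_cvg_to (a := U) (f := fun N => `|c_ N| + r * M1_ N) _ Ml).
    by apply: cvgD; [exact: cvg_norm | apply: cvgM; [exact: cvg_cst|]].
  by apply: filterE => N; have [] := jc N.
Qed.

End Jets.

(** * Germs at a parameter: algebra, identity theorem, composition *)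

Section Germs.
Variable R : realType.

Definition germ (T : R) (h : R -> R) := exists r M,
  0 < r /\ forall p, jet r p M (fun s => h (T + s)).

Lemma germ_cst T c : germ T (fun=> c).
Proof. by exists 1, `|c|; split=> // p; apply: jet_cst. Qed.

Lemma germ_id T : germ T id.
Proof.
exists 1, (`|T| + 1); split=> // p.
by apply: jet_add; [exact: jet_cst | exact: jet_id].
Qed.

Lemma germ_add T h1 h2 :
  germ T h1 -> germ T h2 -> germ T (fun t => h1 t + h2 t).
Proof.
move=> [r1 [M1 [r10 j1]]] [r2 [M2 [r20 j2]]].
have r0 : 0 < Num.min r1 r2 by rewrite lt_min r10.
exists (Num.min r1 r2), (M1 + M2); split=> // p.
by apply: jet_add; [apply: jet_shrink (j1 p)|apply: jet_shrink (j2 p)];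
  rewrite // ge_min lexx ?orbT.
Qed.

Lemma germ_mul T h1 h2 :
  germ T h1 -> germ T h2 -> germ T (fun t => h1 t * h2 t).
Proof.
move=> [r1 [M1 [r10 j1]]] [r2 [M2 [r20 j2]]].
have r0 : 0 < Num.min r1 r2 by rewrite lt_min r10.
exists (Num.min r1 r2), (M1 * M2); split=> // p.
by apply: jet_mul => //; [apply: jet_shrink (j1 p)|apply: jet_shrink (j2 p)];
  rewrite // ge_min lexx ?orbT.
Qed.

Lemma germ_sum T (I : Type) (s : seq I) (h : I -> R -> R) :
  (forall i, germ T (h i)) -> germ T (fun t => \sum_(i <- s) h i t).
Proof.
move=> gh; elim: s => [|i s IH].
  rewrite (_ : (fun t => _) = fun=> 0); first exact: germ_cst.
  by apply/funext => t; rewrite big_nil.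
rewrite (_ : (fun t => _) = fun t => h i t + \sum_(i <- s) h i t).
  exact: germ_add.
by apply/funext => t; rewrite big_cons.
Qed.

Lemma germ_continuous T h : germ T h -> {for T, continuous h}.
Proof.
move=> [r [M [r0 /(_ 1%N) [c [g [M' [E jg _]]]]]]].
have M'0 : 0 <= M' by apply: (@jet_ge0 R r 0 _ g).
have c0 : h T = c by have := E 0; rewrite normr0 addr0 mul0r addr0 => ->.
apply/cvgrPdist_lt => e e0.
have d0 : 0 < Num.min r (e / (M' + 1)).
  by rewrite lt_min r0 divr_gt0 // ltr_wpDl.
near=> t.
have : `|t - T| < Num.min r (e / (M' + 1)).
  by rewrite distrC; near: t; apply: (@nbhsx_ballx R R _ _ d0).
rewrite lt_min => /andP[tr te].
rewrite (_ : t = T + (t - T)); last by ring.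
rewrite E // c0 opprD addNKr normrN normrM.
move: te; rewrite ltr_pdivlMr ?ltr_wpDl //.
have := jg _ tr; have := normr_ge0 (t - T); have := normr_ge0 (g (t - T)); nra.
Unshelve. all: end_near. Qed.

Lemma germ_near0 T h : germ T h ->
  (forall d, 0 < d -> exists2 t, 0 < `|t - T| < d & h t = 0) ->
  \forall t \near T, h t = 0.
Proof.
move=> [r [M [r0 jh]]] zh.
have H := jet_vanish r0 jh.
apply/nbhs_ballP; exists r => //= t; rewrite /ball /= distrC => tr.
have := H _ _ tr; rewrite addrC subrK; apply.
move=> d /zh[s sd hs]; exists (s - T) => //.
by rewrite addrC subrK.
Qed.

(* The partial sums of the power series of g, evaluated along u, have jets of
   norm bounded by a partial sum of the majorant series at (rho/2, ..., rho/2),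
   and jets of bounded norm are stable under pointwise limits. *)
Lemma germ_comp k l (T : R) (u : R -> 'rV[R]_k) (g : 'rV[R]_k -> 'rV[R]_l) :
  (forall i, germ T (fun t => u t 0 i)) -> analytic_at g (u T) ->
  forall j, germ T (fun t => g (u t) 0 j).
Proof.
move=> gu ga j; have [c /nbhs_ballP[rho /= rho0 cg]] := ga j.
pose v i s := u (T + s) 0 i - u T 0 i.
(* Each [v i] vanishes at 0, so [jet_small] brings its norm below [rho / 2] on a small disc. *)
have vsmall i : \forall r \near 0^'+, forall p, jet r p (rho / 2) (v i).
  have [r [M [r0 jv]]] : exists r M, 0 < r /\ forall p, jet r p M (v i).
    have [r [M [r0 ju]]] := gu i; exists r, (M + `|- u T 0 i|); split=> // p.
    by apply: jet_add => //; apply: jet_cst.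
  have M0 := jet_ge0 r0 (jv 0%N).
  near=> r' => p.
  have r'0 : 0 < r' by near: r'; apply: nbhs_right_gt.
  have r'r : r' <= r by near: r'; apply: nbhs_right_le.
  have := jet_small r'0 r'r _ jv p; rewrite /v addr0 subrr => /(_ erefl).
  apply: jet_le; rewrite mulrAC ler_pdivrMr //.
  have : r' <= rho / 2 * r / (M + 1).
    near: r'; apply: nbhs_right_le.
    by rewrite divr_gt0 ?ltr_wpDl // mulr_gt0 ?divr_gt0.
  rewrite ler_pdivlMr ?ltr_wpDl //; nra.
have [r [r0 jv]] : exists r, 0 < r /\ forall i p, jet r p (rho / 2) (v i).
  near (0 : R)^'+ => r; exists r; split; first by near: r; apply: nbhs_right_gt.
  by near: r; apply: filter_forall.
pose x0 : 'rV[R]_k := u T + const_mx (rho / 2).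
have [|cv0 _] := cg x0.
  split=> // i0 i; rewrite /ball /= !mxE ord1 opprD addNKr normrN.
  by rewrite gtr0_norm; lra.
pose M_ d := \sum_(a : {ffun 'I_k -> 'I_d})
  (`|c [ffun i => nat_of_ord (a i)]| * \prod_i (rho / 2) ^+ a i).
have [K HK] : exists K, forall d, M_ d <= K.
  have [K [_ HK]] := cvg_seq_bounded cv0; exists (K + 1) => d.
  apply: le_trans (HK (K + 1) _ d _) => //; last by rewrite ltrDl.
  apply: le_trans (ler_norm _); rewrite /box_sum ler_sum // => a _.
  rewrite /mterm normrM ler_wpM2l // normr_prod le_eqVlt.
  apply/orP; left; apply/eqP/eq_bigr => i _.
  by rewrite normrX !mxE addrAC subrr add0r ffunE gtr0_norm // divr_gt0.
exists r, K; split=> // p.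
(* Limits along [\oo] remain limits along the finer [U], and the bounded [M_] acquires a limit along
   [U], as [jet_lim] requires. *)
have [U [UU sU]] := ultraFilterLemma eventually_filter.
have M0 d : 0 <= M_ d.
  apply: sumr_ge0 => a _; rewrite mulr_ge0 // prodr_ge0 // => i _.
  by rewrite exprn_ge0 // divr_ge0 // ltW.
have /(bounded_ultra_cvg UU)[M Ml] : forall d, `|M_ d| <= K.
  by move=> d; rewrite ger0_norm //; apply: HK.
have MK : M <= K.
  have PU : ProperFilter U := @ultra_proper _ _ UU.
  by apply: (ler_cvg_to (a := U) Ml (cvg_cst K)); apply: (@filterE _ U).
apply: (jet_le MK).
apply: (jet_lim (h_ := fun d s => box_sum (mterm c (u (T + s) - u T)) d)
  UU r0 _ HK Ml).
  move=> d; apply: jet_sum => a; apply: jet_mul => //; first exact: jet_cst.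
  apply: jet_prod => // i.
  have := jet_exp (a i) r0 (jv i p); apply: jet_ext => s sr.
  by rewrite !mxE ffunE.
move=> s sr; have [|_ H] := cg (u (T + s)); last first.
  exact: (cvg_trans (cvg_app _ sU) H).
split=> // i0 i; rewrite ord1 /ball /= -normrN opprB.
by apply: le_lt_trans (jet_bound r0 (jv i 0%N) sr) _; lra.
Unshelve. all: end_near. Qed.

End Germs.

(** * Analytic curves in charts *)

Lemma fwd_cvg (S T : topologicalType) (c : partial_homeo S T) x :
  open (src c) -> src c x -> {for x, continuous (fwd c)}.
Proof.
move=> oc cx; have := @fwd_continuous _ _ c.
rewrite continuous_open_subspace //.
by apply; rewrite inE.
Qed.

Lemma bwd_cvg (S T : topologicalType) (c : partial_homeo S T) y :
  open (tgt c) -> tgt c y -> {for y, continuous (bwd c)}.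
Proof.
move=> oc cy; have := @bwd_continuous _ _ c.
rewrite continuous_open_subspace //.
by apply; rewrite inE.
Qed.

Section Curves.
Variable R : realType.

Lemma cvg_rV (T : Type) (F : set_system T) k (u : T -> 'rV[R]_k)
    (l : 'rV[R]_k) :
  Filter F -> (forall i, u x 0 i @[x --> F] --> l 0 i) -> u @ F --> l.
Proof.
move=> FF H; apply/cvg_ballP => e e0.
have : \forall x \near F, forall j, ball (l 0 j) e (u x 0 j).
  by apply: filter_forall => j; have /cvg_ballP := H j; apply.
by apply: filterS => x xb; split=> // i j; rewrite ord1.
Qed.

Definition germ_rV k (T : R) (u : R -> 'rV[R]_k) :=
  forall i, germ T (fun t => u t 0 i).

Lemma germ_rV_continuous k (T : R) (u : R -> 'rV[R]_k) :
  germ_rV T u -> {for T, continuous u}.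
Proof. by move=> gu; apply: cvg_rV => i; apply: (germ_continuous (gu i)). Qed.

Lemma germ_within k l (S : set 'rV[R]_k) (T : R) (u : R -> 'rV[R]_k)
    (g : 'rV[R]_k -> 'rV[R]_l) :
  germ_rV T u -> analytic_within S g (u T) ->
  exists2 w, germ_rV T w & \forall t \near T, S (u t) -> g (u t) = w t.
Proof.
move=> gu [e ae ge]; exists (e \o u); first exact: germ_comp.
by have /(_ _ ge) := germ_rV_continuous gu.
Qed.

Lemma germ_rV_const_mx (T : R) : germ_rV T (fun t => const_mx t : 'rV[R]_1).
Proof.
move=> i; rewrite (_ : (fun t => _) = id); first exact: germ_id.
by apply/funext => t; rewrite mxE.
Qed.

Section Charts.
Variables (n : nat) (N : topologicalType).
Variable A : set (partial_homeo 'rV[R]_n N).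
Hypothesis atlasA : analytic_atlas A.
Variable Gamma : R -> N.
Hypothesis curveG : analytic_curve A Gamma.
Variable T : R.
Hypothesis T01 : 0 <= T <= 1.

(** Even when [T] is an end point, [u] is analytic on a full neighborhood of [T], since analyticity
    on [[0, 1]] supplies a local ambient extension. Only its agreement with [Gamma] is restricted to
    [[0, 1]]. *)
Lemma curve_local : exists c u, [/\ A c, germ_rV T u &
  \forall t \near T, 0 <= t <= 1 -> tgt c (Gamma t) /\ bwd c (Gamma t) = u t].
Proof.
have uT : @unit_interval R (const_mx T) by rewrite /unit_interval /= mxE.
have [c Ac [nt aw]] := curveG uT.
have [u gu uE] := germ_within (@germ_rV_const_mx T) aw.
exists c, u; split => //.
have cT := germ_rV_continuous (@germ_rV_const_mx T).
near=> t => t01.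
have ut : @unit_interval R (const_mx t) by rewrite /unit_interval /= mxE.
split.
  rewrite (_ : Gamma t = Gamma ((const_mx t : 'rV[R]_1) 0 0)); last by rewrite mxE.
  by move: ut; near: t; apply: (cT _ nt).
have -> : Gamma t = Gamma ((const_mx t : 'rV[R]_1) 0 0) by rewrite mxE.
by move: ut; near: t.
Unshelve. all: end_near. Qed.

Lemma curve_continuous :
  Gamma t @[t --> within [set t | 0 <= t <= 1] (nbhs T)] --> Gamma T.
Proof.
have [c [u [Ac gu nt]]] := curve_local.
have [/(_ _ Ac)[oc _] _ _] := atlasA.
have [tcT uT] := nbhs_singleton nt T01.
have fu : fwd c (u t) @[t --> T] --> Gamma T.
  rewrite -(bwdK tcT) uT.
  apply: (continuous_comp (germ_rV_continuous gu)).
  by apply: fwd_cvg => //; rewrite -uT; apply: bwd_src.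
move=> V /fu Vu.
change (\forall t \near T, 0 <= t <= 1 -> V (Gamma t)); near=> t => t01.
have [tct utE] : tgt c (Gamma t) /\ bwd c (Gamma t) = u t.
  by move: t01; near: t.
by rewrite -(bwdK tct) utE; near: t.
Unshelve. all: end_near. Qed.

(** [F] need not belong to [A]. Two germ compositions are used: the transition from a chart [c] in
    which [Gamma] is analytic to a chart [c'] in which [bwd F] is analytic, followed by
    [bwd F \o fwd c']. *)
Lemma curve_chart (F : partial_homeo 'rV[R]_n N) :
  open (tgt F) -> tgt F (Gamma T) -> analytic_from A (tgt F) (bwd F) ->
  exists2 g, germ_rV T g &
  \forall t \near T, 0 <= t <= 1 -> tgt F (Gamma t) /\ bwd F (Gamma t) = g t.
Proof.
move=> oF FT aF.
have [c [u [Ac gu nt]]] := curve_local.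
have [tcT uT] := nbhs_singleton nt T01.
have [oA _ tA] := atlasA.
have [c' Ac' [tc'T aw']] := aF _ FT.
have [_ otc'] := oA _ Ac'.
have SuT : (src c `&` fwd c @^-1` tgt c') (u T).
  by rewrite -uT; split => /=; [exact: bwd_src | rewrite bwdK].
have [w gw wE] := germ_within gu (tA _ _ Ac Ac' _ SuT).
have wT : w T = bwd c' (Gamma T).
  by rewrite -(nbhs_singleton wE SuT) -uT /= bwdK.
rewrite -wT in aw'.
have [g gg gE] := germ_within gw aw'.
exists g => //.
have n1 := curve_continuous (open_nbhs_nbhs (conj otc' tc'T)).
have n2 := curve_continuous (open_nbhs_nbhs (conj oF FT)).
near=> t => t01.
have [tct utE] : tgt c (Gamma t) /\ bwd c (Gamma t) = u t.
  by move: t01; near: t.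
have tc't : tgt c' (Gamma t) by move: t01; near: t.
have Ft : tgt F (Gamma t) by move: t01; near: t.
split=> //.
have wt : w t = bwd c' (Gamma t).
  rewrite (_ : w t = (bwd c' \o fwd c) (u t)).
    by rewrite /= -utE bwdK.
  apply/esym; have : (src c `&` fwd c @^-1` tgt c') (u t).
    by rewrite -utE; split => /=; [exact: bwd_src | rewrite bwdK].
  by near: t.
rewrite (_ : g t = (bwd F \o fwd c') (w t)).
  by rewrite /= wt bwdK.
apply/esym; have : (src c' `&` fwd c' @^-1` tgt F) (w t).
  by rewrite wt; split => /=; [exact: bwd_src | rewrite bwdK].
by near: t.
Unshelve. all: end_near. Qed.

End Charts.
End Curves.

(** * Straightening coordinates and local lifts *)

Section Padding.
Variables (R : realType) (k n : nat).
Hypothesis kn : (k <= n)%N.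

Definition trunc (b : 'rV[R]_n) : 'rV[R]_k := \row_i b 0 (widen_ord kn i).

Lemma pad0K : cancel (@pad0 R k n) trunc.
Proof.
move=> a; apply/rowP => i; rewrite !mxE.
case: insubP => [j _ ji|]; last by rewrite /= ltn_ord.
by congr (a _ _); apply/val_inj.
Qed.

Lemma pad0_ge (a : 'rV[R]_k) (j : 'I_n) : (k <= j)%N -> pad0 n a 0 j = 0.
Proof. by move=> kj; rewrite mxE insubN // -leqNgt. Qed.

Lemma truncK (b : 'rV[R]_n) :
  (forall j : 'I_n, (k <= j)%N -> b 0 j = 0) -> pad0 n (trunc b) = b.
Proof.
move=> b0; apply/rowP => j; rewrite mxE.
case: insubP => [i _ ij|]; last by rewrite -leqNgt => /b0 ->.
by rewrite mxE; congr (b _ _); apply/val_inj; rewrite /= -ij.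
Qed.

Lemma trunc_continuous : continuous trunc.
Proof.
move=> b; apply: (@cvg_rV _ _ (nbhs b)) => i; rewrite mxE.
apply: (cvg_trans _ (@coord_continuous _ _ _ _ _ b)).
by apply: near_eq_cvg; apply: nearW => x; rewrite mxE.
Qed.

Lemma pad0_continuous : continuous (@pad0 R k n).
Proof.
move=> a; apply: (@cvg_rV _ _ (nbhs a)) => j; rewrite mxE.
case E : insub => [i|].
  apply: (cvg_trans _ (@coord_continuous _ _ _ _ i a)).
  by apply: near_eq_cvg; apply: nearW => x; rewrite mxE E.
apply: (cvg_trans _ (@cvg_cst _ 0 _ (nbhs a) _)).
by apply: near_eq_cvg; apply: nearW => x; rewrite mxE E.
Qed.
End Padding.

Section Cone.
Variables (R : realType) (m : nat).

(** The cone as the zero set of one polynomial, so that the identity theorem applies to it along a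
    curve. *)
Definition cone_form (x : 'rV[R]_(m + 1)) : R :=
  \sum_j (lsubmx x 0 j) ^+ 2 - (rsubmx x 0 0) ^+ 2.

Lemma cone_form_eq0 x : double_cone x <-> cone_form x = 0.
Proof.
rewrite /cone_form /double_cone /=; split=> [->|/eqP]; first by rewrite subrr.
by rewrite subr_eq0 => /eqP.
Qed.

Lemma germ_cone_form T (u : R -> 'rV[R]_(m + 1)) :
  germ_rV T u -> germ T (fun t => cone_form (u t)).
Proof.
move=> gu; rewrite (_ : (fun t => _) = fun t =>
  \sum_j (u t 0 (lshift 1 j) * u t 0 (lshift 1 j)) +
   -1 * (u t 0 (rshift m 0) * u t 0 (rshift m 0))).
  apply: germ_add; first by apply: germ_sum => j; apply: germ_mul.
  by apply: germ_mul; [exact: germ_cst | apply: germ_mul].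
apply/funext => t; rewrite /cone_form mulN1r !mxE; congr (_ - _).
by apply: eq_bigr => j _; rewrite !mxE.
Qed.
End Cone.

Lemma near_between (R : realFieldType) (a b t : R) :
  a < t < b -> \forall s \near t, a < s < b.
Proof.
by move=> abt; have /(_ t) := @near_in_itvoo R a b; rewrite in_itv; apply.
Qed.

Section Immersion.
Variables (R : realType) (m n : nat) (X N : topologicalType).
Variables (D : set (partial_homeo 'rV[R]_(m + 1) X)).
Variables (A : set (partial_homeo 'rV[R]_n N)) (f : X -> N).
Hypothesis (lt_mn : (m < n)%N).
Hypothesis D_coord : forall c, D c -> DC_coord c.
Hypothesis atlasA : analytic_atlas A.
Hypothesis f_imm : DC_immersion D A f.

Let le_m1n : (m + 1 <= n)%N. Proof. by rewrite addn1. Qed.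

Definition straightens (c : partial_homeo 'rV[R]_(m + 1) X)
    (F : partial_homeo 'rV[R]_n N) :=
  forall a, src c a -> src F (pad0 n a) /\ fwd F (pad0 n a) = f (fwd c a).

Lemma straight_chart p : exists c F,
  [/\ DC_coord c, tgt c p, open (src F), open (tgt F) &
    [/\ tgt F (f p), analytic_from A (tgt F) (bwd F) & straightens c F]].
Proof.
have [c [Dc cp [F [[oF _] [otF Fp] _ aF st]]]] := f_imm p.
by exists c, F; split=> //; exact: D_coord.
Qed.

Lemma straightens_bwd c F q : straightens c F -> tgt c q ->
  bwd F (f q) = pad0 n (bwd c q).
Proof.
move=> st cq; have [sF] := st _ (bwd_src cq); rewrite bwdK // => <-.
by rewrite fwdK.
Qed.

(** In straightening coordinates [f] is [a |-> (a, 0)]. *)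
Lemma locally_injective p :
  exists2 V, open_nbhs p V & forall q q', V q -> V q' -> f q = f q' -> q = q'.
Proof.
have [c [F [[_ oc _] cp _ _ [_ _ st]]]] := straight_chart p.
exists (tgt c) => // q q' cq cq' /(congr1 (bwd F)).
rewrite !(straightens_bwd st) // => /(can_inj (pad0K le_m1n)) /(congr1 (fwd c)).
by rewrite !bwdK.
Qed.

Lemma immersion_continuous : continuous f.
Proof.
move=> p; have [c [F [[_ oc _] cp oF otF [_ _ st]]]] := straight_chart p.
have [sF fE] := st _ (bwd_src cp); rewrite bwdK // in fE.
have pc : {for p, continuous (@pad0 R _ n \o bwd c)}.
  by apply: continuous_comp; [exact: bwd_cvg | exact: pad0_continuous].
have H : {for p, continuous (fwd F \o (@pad0 R _ n \o bwd c))}.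
  by apply: continuous_comp => //; exact: fwd_cvg.
rewrite /continuous_at -fE.
apply: cvg_trans H; apply: near_eq_cvg.
apply: filterS (open_nbhs_nbhs (conj oc cp)) => q cq /=.
by have [_ ->] := st _ (bwd_src cq); rewrite bwdK.
Qed.

Variable Gamma : R -> N.
Hypothesis curveG : analytic_curve A Gamma.

Lemma curve_interior_continuous t : 0 < t < 1 -> {for t, continuous Gamma}.
Proof.
move=> t01o V VG.
have t01 : 0 <= t <= 1 by case/andP: t01o => *; rewrite !ltW.
have H := curve_continuous atlasA curveG t01 VG.
have H' : \forall s \near t, 0 <= s <= 1 -> V (Gamma s) by exact: H.
change (\forall s \near t, V (Gamma s)).
near=> s; have : 0 <= s <= 1.
  have /andP[*] : 0 < s < 1 by near: s; exact: near_between.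
  by rewrite !ltW.
by near: s.
Unshelve. all: end_near. Qed.

(* V isolates a single sheet of f, which makes the local lift pass through every
   nearby point of V over Gamma. *)
Lemma local_lift T p : 0 < T < 1 -> f p = Gamma T ->
  (forall V d, nbhs p V -> 0 < d ->
    exists t q, [/\ 0 < `|t - T| < d, 0 <= t <= 1, V q & f q = Gamma t]) ->
  exists sigma : R -> X, exists2 V, open_nbhs p V &
    \forall t \near T, [/\ {for t, continuous sigma}, f (sigma t) = Gamma t &
      forall q, V q -> f q = Gamma t -> q = sigma t].
Proof.
move=> T01 fp acc.
have T01' : 0 <= T <= 1 by case/andP: T01 => *; rewrite !ltW.
have [c [F [[ocone oc _] cp oF otF [Fp aF st]]]] := straight_chart p.
rewrite fp in Fp.
have [g gg gE] := curve_chart atlasA curveG T01' otF Fp aF.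
(* At parameters accumulating at [T], the curve read in the straightening chart lies on the padded
   cone patch. *)
have acc_g d : 0 < d -> exists2 t, 0 < `|t - T| < d &
    exists2 a, src c a & g t = pad0 n a.
  move=> d0; move/nbhs_ballP: gE => [e /= e0 gE].
  have [] := acc (tgt c) (Num.min d e) (open_nbhs_nbhs (conj oc cp)).
    by rewrite lt_min d0.
  move=> t [q [/andP[t0]]]; rewrite lt_min => /andP[td te] t01 cq fq.
  exists t; first by rewrite t0.
  exists (bwd c q); first exact: bwd_src.
  have [|_ <-] := gE t _ t01; first by rewrite /ball /= distrC.
  by rewrite -fq (straightens_bwd st).
have src_cone a : src c a -> double_cone a.
  by move: ocone => [W _ ->] [].
(* By the identity theorem, the equations of the patch hold at all parameters near [T]: first the
   padding coordinates, then the cone equation. *)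
have g0 (j : 'I_n) : (m + 1 <= j)%N -> \forall t \near T, g t 0 j = 0.
  move=> mj; apply: (germ_near0 (gg j)) => d /acc_g[t td [a _ ga]].
  by exists t; rewrite // ga pad0_ge.
have gcone : \forall t \near T, cone_form (trunc le_m1n (g t)) = 0.
  apply: germ_near0 => [|d /acc_g[t td [a /src_cone/cone_form_eq0 a0 ga]]].
    apply: germ_cone_form => i.
    rewrite (_ : (fun t => _) = fun t => g t 0 (widen_ord le_m1n i)) //.
    by apply/funext => t; rewrite mxE.
  by exists t; rewrite // ga pad0K.
have gpad : \forall t \near T, pad0 n (trunc le_m1n (g t)) = g t.
  have : \forall t \near T, forall j : 'I_n, (m + 1 <= j)%N -> g t 0 j = 0.
    apply: (@filter_forall _ _
      (fun (j : 'I_n) t => (m + 1 <= j)%N -> g t 0 j = 0) (nbhs T)) => j.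
    have [/g0|mj] := boolP (m + 1 <= j)%N; first by apply: filterS.
    exact: nearW.
  by apply: filterS => t; apply: truncK.
have gT : trunc le_m1n (g T) = bwd c p.
  have [_ <-] := nbhs_singleton gE T01'.
  by rewrite -fp (straightens_bwd st) // pad0K.
(* [src c] is open only relative to the cone: continuity gives membership in the ambient open set
   [W], and [gcone] gives membership in the cone. *)
have gsrc : \forall t \near T, src c (trunc le_m1n (g t)).
  have [W oW cW] := ocone.
  have Wp : W (trunc le_m1n (g T)).
    by rewrite gT; move: (bwd_src cp); rewrite cW => -[].
  have gt : {for T, continuous (trunc le_m1n \o g)}.
    apply: continuous_comp; last exact: trunc_continuous.
    exact: (germ_rV_continuous gg).
  near=> t; rewrite cW; split.
    by near: t; exact: (gt _ (open_nbhs_nbhs (conj oW Wp))).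
  by apply/cone_form_eq0; near: t.
(* The lift is built from [Gamma] rather than from [g]: continuity is needed at every [t] near [T],
   whereas [germ_rV_continuous] gives that of [g] only at [T]. *)
pose w t := trunc le_m1n (bwd F (Gamma t)).
have wE : \forall t \near T, [/\ 0 < t < 1, tgt F (Gamma t), src c (w t) &
    fwd F (pad0 n (w t)) = Gamma t].
  near=> t.
  have t01 : 0 < t < 1 by near: t; exact: near_between.
  have t01' : 0 <= t <= 1 by case/andP: t01 => *; rewrite !ltW.
  have [Ft gt] : tgt F (Gamma t) /\ bwd F (Gamma t) = g t.
    by move: t01'; near: t.
  split=> //; rewrite /w gt; first by near: t.
  rewrite (_ : pad0 _ _ = g t); last by near: t.
  by rewrite -gt bwdK.
exists (fwd c \o w), (tgt c) => //.
near=> t.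
have [t01 Ft wt wG] : [/\ 0 < t < 1, tgt F (Gamma t), src c (w t) &
    fwd F (pad0 n (w t)) = Gamma t] by near: t.
have fsig : f (fwd c (w t)) = Gamma t.
  by have [_ <-] := st _ wt.
split=> //.
- have bc : {for t, continuous (bwd F \o Gamma)}.
    apply: continuous_comp; last exact: bwd_cvg.
    exact: curve_interior_continuous.
  have wc : {for t, continuous (trunc le_m1n \o (bwd F \o Gamma))}.
    by apply: continuous_comp => //; exact: trunc_continuous.
  have /subspace_continuousP/(_ _ wt) cc := @fwd_continuous _ _ c.
  have ws : \forall s \near t, src c (w s).
    near: t; apply: filterS (near_join wE) => t.
    by apply: filterS => s [].
  move=> V /cc /wc Vw; change (\forall s \near t, V (fwd c (w s))).
  near=> s; have : src c (w s) by near: s.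
  by near: s; exact: Vw.
- move=> q cq fq.
  rewrite /= /w -fq (straightens_bwd st) // pad0K bwdK //.
Unshelve. all: end_near. Qed.

End Immersion.

(** * Maximal lifts *)

Section Reparametrization.
Variable R : realType.

Lemma affine_continuous k (b : 'rV[R]_k) (z : R) :
  continuous (fun x : 'rV[R]_k => b + z *: x).
Proof.
move=> a; apply: (@cvg_rV _ _ (nbhs a)) => i; rewrite !mxE.
apply: (@cvg_trans _ (b 0 i + z * x 0 i @[x --> a])).
  by apply: near_eq_cvg; apply: nearW => x; rewrite !mxE.
have cx := @coord_continuous R 1 k 0 i a.
exact: (cvgD (@cvg_cst _ (b 0 i) _ (nbhs a) _)
  (cvgM (@cvg_cst _ z _ (nbhs a) _) cx)).
Qed.

(** As [(b + z x) - (b + z a) = z (x - a)], it suffices to multiply the coefficient of index [alpha]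
    by [z] to the power of the total degree of [alpha]. *)
Lemma analytic_at_affine k l (g : 'rV[R]_k -> 'rV[R]_l) (b : 'rV[R]_k)
    (z : R) (a : 'rV[R]_k) :
  analytic_at g (b + z *: a) -> analytic_at (fun x => g (b + z *: x)) a.
Proof.
move=> ga j; have [c nc] := ga j.
exists (fun alpha => c alpha * \prod_i z ^+ alpha i).
have /(_ _ nc) := @affine_continuous _ b z a.
rewrite nbhs_simpl /=; apply: filterS => x [].
suff E : mterm c (b + z *: x - (b + z *: a)) =
    mterm (fun alpha => c alpha * \prod_i z ^+ alpha i) (x - a) by rewrite E.
apply/funext => alpha; rewrite /mterm -mulrA -big_split /=; congr (_ * _).
by apply: eq_bigr => i _; rewrite -exprMn !mxE; congr (_ ^+ _); ring.
Qed.

(** Arc-properness speaks of curves on [[0, 1]]; this rescales a piece of [Gamma] over [[a, b]] to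
    that interval. *)
Lemma analytic_curve_affine n (N : topologicalType)
    (A : set (partial_homeo 'rV[R]_n N)) Gamma (a b : R) :
  0 <= a -> a <= b -> b <= 1 -> analytic_curve A Gamma ->
  analytic_curve A (fun s => Gamma (a + s * (b - a))).
Proof.
move=> a0 ab b1 cG x x01.
pose aff (y : 'rV[R]_1) : 'rV[R]_1 := const_mx a + (b - a) *: y.
have aff01 y : unit_interval y -> unit_interval (aff y).
  rewrite /unit_interval /= !mxE => /andP[y0 y1]; apply/andP; split; nra.
have affE (y : 'rV[R]_1) : Gamma (a + y 0 0 * (b - a)) = Gamma (aff y 0 0).
  by rewrite !mxE mulrC.
have affc : {for x, continuous aff} by exact: affine_continuous.
have [c Ac [nt [e ae ge]]] := cG _ (aff01 _ x01).
exists c => //; split.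
  have /(_ _ nt) := affc; rewrite nbhs_simpl /=; apply: filterS => y H y01.
  by rewrite affE; apply: H; apply: aff01.
exists (e \o aff); first exact: analytic_at_affine.
have /(_ _ ge) := affc; rewrite nbhs_simpl /=; apply: filterS => y H y01.
by rewrite /= affE; apply: H; apply: aff01.
Qed.
End Reparametrization.

Section Lifts.
Variables (R : realType) (X N : topologicalType) (f : X -> N) (Gamma : R -> N).

Definition is_lift (a b : R) (sigma : R -> X) :=
  forall t, a < t < b -> {for t, continuous sigma} /\ f (sigma t) = Gamma t.

Lemma lift_sub (a b a' b' : R) s :
  a <= a' -> b' <= b -> is_lift a b s -> is_lift a' b' s.
Proof.
move=> aa bb ls t /andP[t1 t2]; apply: ls.
by rewrite (le_lt_trans aa) // (lt_le_trans t2).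
Qed.

(** The set where the lifts agree is open by local injectivity and relatively closed because [X] is
    Hausdorff; the interval is connected. *)
Lemma lift_unique (a b t0 : R) s1 s2 : hausdorff_space X ->
  (forall p, exists2 V, open_nbhs p V &
     forall q q', V q -> V q' -> f q = f q' -> q = q') ->
  a < t0 < b -> is_lift a b s1 -> is_lift a b s2 -> s1 t0 = s2 t0 ->
  forall t, a < t < b -> s1 t = s2 t.
Proof.
move=> hX inj t0ab l1 l2 e0 t tab.
pose E := [set s : R | a < s < b /\ s1 s = s2 s].
pose E' := [set s : R | a < s < b /\ s1 s <> s2 s].
have conn : connected `]a, b[%classic.
  by apply/connected_intervalP/interval_is_interval.
have /seteqP[_ /(_ t)] : E = `]a, b[%classic; last first.
  by rewrite /= in_itv /= => /(_ tab)[].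
apply: conn; first by exists t0.
  exists E; last first.
    by apply/seteqP; split => [s [sab es]|s []] //; split; rewrite //= in_itv.
  rewrite openE => s [sab es].
  have [V oV injV] := inj (s1 s).
  have [c1 f1] := l1 s sab; have [c2 f2] := l2 s sab.
  have V1 := c1 _ (open_nbhs_nbhs oV).
  have V2 : nbhs (s2 s) V by rewrite -es; exact: open_nbhs_nbhs.
  move/c2: V2 => V2.
  rewrite /interior; change (\forall u \near s, E u); near=> u.
  have uab : a < u < b by near: u; exact: near_between.
  split=> //; apply: injV; [near: u; exact: V1|near: u; exact: V2|].
  by have [_ ->] := l1 u uab; have [_ ->] := l2 u uab.
exists (~` E'); last first.
  apply/seteqP; split => [s [sab es]|s []].
    by split; [rewrite /= in_itv|case].
  rewrite /= in_itv /= => sab ns; split=> //.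
  by apply: contrapT => es; apply: ns.
apply: open_closedC; rewrite openE => s [sab /eqP es].
move: (hX); rewrite open_hausdorff => /(_ _ _ es) [[V1 V2]] /= [].
rewrite !inE => s1V s2V [V1o V2o V12].
have [c1 f1] := l1 s sab; have [c2 f2] := l2 s sab.
have n1 := c1 _ (open_nbhs_nbhs (conj V1o s1V)).
have n2 := c2 _ (open_nbhs_nbhs (conj V2o s2V)).
rewrite /interior; change (\forall u \near s, E' u); near=> u.
split; first by near: u; exact: near_between.
move=> eu; have : (V1 `&` V2) (s1 u).
  split; first by near: u; exact: n1.
  by rewrite eu; near: u; exact: n2.
by rewrite V12.
Unshelve. all: end_near. Qed.

(** No continuity of [q] is assumed. If every [(t, q t)] were isolated in the graph, a basic open
    set and two rationals would determine [t], and the interval would be countable, against its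
    positive Lebesgue measure. *)
Lemma curve_accumulation eps (q : R -> X) : @second_countable X -> 0 < eps ->
  exists2 t0, 0 < t0 < eps & forall V d, nbhs (q t0) V -> 0 < d ->
    exists t, [/\ 0 < `|t - t0| < d, 0 < t < eps & V (q t)].
Proof.
move=> [B /countable_injP[iB injB] [Bo Bb]] eps0.
apply: contrapT => H.
have iso t : exists z : set X * (rat * rat), 0 < t < eps ->
    [/\ B z.1, z.1 (q t), ratr z.2.1 < t < ratr z.2.2 &
    forall s, 0 < s < eps -> z.1 (q s) -> ratr z.2.1 < s < ratr z.2.2 -> s = t].
  have [t0e|] := boolP (0 < t < eps); last by exists (set0, (0, 0)).
  have [V [d [Vt d0 iso]]] : exists V d, [/\ nbhs (q t) V, 0 < d &
      forall s, 0 < s < eps -> V (q s) -> `|s - t| < d -> s = t].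
    apply: contrapT => H1; apply: H; exists t => // V d Vt d0.
    apply: contrapT => H2; apply: H1; exists V, d; split=> // s se Vs sd.
    apply: contrapT => /eqP st; apply: H2; exists s; split=> //.
    by rewrite normr_gt0 subr_eq0 st.
  have [W [BW Wq] WV] := Bb (q t) _ Vt.
  have /rat_in_itvoo[x] : t - d < t by lra.
  have /rat_in_itvoo[y] : t < t + d by lra.
  rewrite !in_itv /= => /andP[y1 y2] /andP[x1 x2].
  exists (W, (x, y)) => _ /=; split=> //; first by rewrite x2 y1.
  move=> s se Ws /andP[s1 s2]; apply: iso => //; first exact: WV.
  by rewrite ltr_norml; apply/andP; split; lra.
have [z zE] := choice iso.
have cnt : countable `]0, eps[%classic.
  apply/countable_injP; exists (fun t => pickle (iB (z t).1, (z t).2)).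
  move=> t s; rewrite !inE /= !in_itv /= => te se.
  move/(pcan_inj pickleK) => [/injB].
  have [Bt zt rt it] := zE t te; have [Bs zs rs _] := zE s se.
  rewrite !inE => /(_ Bt Bs) e1 e2.
  by apply/esym/it; rewrite // ?e1 ?e2.
have := countable_lebesgue_measure0 cnt.
rewrite lebesgue_measure_itv /= lte_fin eps0 sube0 => -[] /eqP.
by rewrite gt_eqF.
Qed.

End Lifts.

(** [U k] is the intersection of the basic neighborhoods of [p] whose index is below [k]. It serves
    to extract a sequence from a cluster point. *)
Lemma countable_nbhs_basis (T : topologicalType) (p : T) :
  @second_countable T ->
  exists U : nat -> set T, (forall k, nbhs p (U k)) /\
    forall V, nbhs p V -> \forall k \near \oo, U k `<=` V.
Proof.
move=> [B /countable_injP[i injB] [Bo Bb]].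
exists (fun k x => forall W, B W -> W p -> (i W < k)%N -> W x); split.
  elim=> [|k IH]; first by apply: filterE.
  have [[W [BW Wp iW]]|noW] := pselect (exists W, [/\ B W, W p & i W = k]).
    have Wn : nbhs p W by apply: open_nbhs_nbhs; split=> //; exact: Bo.
    apply: filterS2 IH Wn => x Ux Wx W' BW' W'p.
    rewrite ltnS leq_eqVlt => /orP[/eqP iW'|]; last exact: Ux.
    by rewrite (injB W' W) ?inE // iW'.
  apply: filterS IH => x Ux W BW Wp; rewrite ltnS leq_eqVlt => /orP[/eqP iW|].
    by exfalso; apply: noW; exists W.
  exact: Ux.
move=> V /Bb[W [BW Wp] WV]; exists (i W).+1 => // k /= ik x Ux.
by apply: WV; apply: Ux.
Qed.

Lemma near_eq_continuous (S T : topologicalType) (g h : S -> T) x :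
  (\forall y \near x, g y = h y) -> {for x, continuous g} ->
  {for x, continuous h}.
Proof.
move=> gh gc; rewrite /prop_for /continuous_at -(nbhs_singleton gh).
apply: cvg_trans gc; apply: near_eq_cvg.
by apply: filterS gh => y ->.
Qed.

(** [T] is the supremum of the right ends of the lifts through [s0 t0]. These lifts agree wherever
    two are defined, by [lift_unique], so they patch together. *)
Lemma lift_maximal (R : realType) (X N : topologicalType) (f : X -> N)
    (Gamma : R -> N) (a b0 t0 : R) (s0 : R -> X) :
  hausdorff_space X ->
  (forall p, exists2 V, open_nbhs p V &
     forall q q', V q -> V q' -> f q = f q' -> q = q') ->
  a < t0 < b0 -> b0 <= 1 -> is_lift f Gamma a b0 s0 ->
  exists T s, [/\ t0 < T <= 1, is_lift f Gamma a T s &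
    forall b s', b <= 1 -> is_lift f Gamma a b s' -> s' t0 = s t0 -> b <= T].
Proof.
move=> hX inj /andP[at0 t0b0] b01 ls0.
pose L := [set b | t0 < b <= 1 /\
  exists2 s, is_lift f Gamma a b s & s t0 = s0 t0].
have Lb0 : L b0 by rewrite /L /= t0b0; split=> //; exists s0.
have L1 : ubound L 1 by move=> b [/andP[]].
have supL : has_sup L by split; [exists b0 | exists 1].
have LT b : L b -> b <= sup L by move=> Lb; apply: sup_upper_bound.
have T1 : sup L <= 1 by apply: ge_sup => //; exists b0.
have t0T : t0 < sup L by apply: lt_le_trans (LT _ Lb0).
(* [S t] is a lift together with its right end, chosen beyond [t]; the patched lift takes the value
   [(S t).1 t] at [t]. *)
have /choice[S SE] t : exists z : (R -> X) * R, a < t < sup L ->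
    [/\ is_lift f Gamma a z.2 z.1, z.1 t0 = s0 t0, t < z.2, t0 < z.2 &
    z.2 <= sup L].
  have [/andP[_ tT]|_] := boolP (a < t < sup L); last by exists (s0, 0).
  have e0 : 0 < sup L - t by rewrite subr_gt0.
  have [b Lb] := sup_adherent e0 supL; rewrite opprB addrC subrK => tb.
  have [/andP[t0b _] [s ls st0]] := Lb.
  by exists (s, b) => _; split=> //=; exact: LT.
have SS t u : a < t < sup L -> a < u < sup L -> u < (S t).2 ->
    (S u).1 u = (S t).1 u.
  move=> tT uT ut; have [lt et _ t0t _] := SE t tT.
  have [lu eu uu t0u _] := SE u uT.
  apply: (@lift_unique _ _ _ f Gamma a (Num.min (S t).2 (S u).2) t0) => //.
  - by rewrite at0 lt_min t0t.
  - by apply: lift_sub lu; rewrite // ge_min lexx orbT.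
  - by apply: lift_sub lt; rewrite // ge_min lexx.
  - by rewrite eu et.
  - by case/andP: uT => -> _; rewrite lt_min ut.
have St0 : (S t0).1 t0 = s0 t0 by have [|] := SE t0; rewrite ?at0.
exists (sup L), (fun t => (S t).1 t); split; first by rewrite t0T.
  move=> t tT; have [lt _ tt _ leT] := SE t tT.
  have [|ct ft] := lt t; first by case/andP: tT => ->.
  split=> //; apply: near_eq_continuous ct; near=> u.
  apply/esym/SS => //.
    by near: u; exact: near_between.
  by near: u; exact: lt_nbhsl.
move=> b s b1 ls st0; have [t0b|bt0] := ltP t0 b.
  by apply: LT; split; [rewrite t0b | exists s; rewrite // st0].
by rewrite (le_trans bt0) // ltW.
Unshelve. all: end_near. Qed.

(** Agreement at the single point [tau] spreads to the whole overlap by [lift_unique], so switching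
    from [s1] to [s2] at [tau] preserves continuity. *)
Lemma lift_glue (R : realType) (X N : topologicalType) (f : X -> N)
    (Gamma : R -> N) (a T d tau : R) (s1 s2 : R -> X) :
  hausdorff_space X ->
  (forall p, exists2 V, open_nbhs p V &
     forall q q', V q -> V q' -> f q = f q' -> q = q') ->
  is_lift f Gamma a T s1 -> is_lift f Gamma (T - d) (T + d) s2 ->
  a < tau < T -> T - d < tau -> s1 tau = s2 tau ->
  exists2 s, is_lift f Gamma a (T + d) s & forall t, t <= tau -> s t = s1 t.
Proof.
move=> hX inj l1 l2 /andP[atau tauT] dtau e.
have e12 t : Num.max a (T - d) < t < T -> s1 t = s2 t.
  apply: (lift_unique hX inj (t0 := tau)) => //.
  - by rewrite gt_max atau dtau.
  - by apply: lift_sub l1; rewrite // le_max lexx.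
  - by apply: lift_sub l2; rewrite ?le_max ?lexx ?orbT //; lra.
exists (fun t => if t <= tau then s1 t else s2 t) => [t /andP[aT td]|t ->] //.
case: (leP t tau) => ttau.
  have [|c1 f1] := l1 t; first by rewrite aT (le_lt_trans ttau).
  split=> //; apply: near_eq_continuous c1; near=> u.
  case: (leP u tau) => // tauu; apply: e12.
  rewrite gt_max (lt_trans atau tauu) (lt_trans dtau tauu) /=.
  by near: u; apply: lt_nbhsl; apply: le_lt_trans ttau tauT.
have [|c2 f2] := l2 t; first by rewrite td (lt_trans dtau).
split=> //; apply: near_eq_continuous c2; near=> u.
have : tau < u by near: u; exact: lt_nbhsr.
by rewrite ltNge => /negbTE ->.
Unshelve. all: end_near. Qed.

(** * Completeness of the image, and arc-properness of proper maps *)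

Section Completeness.
Variables (R : realType) (m n : nat) (X N : topologicalType).
Variables (D : set (partial_homeo 'rV[R]_(m + 1) X)).
Variables (A : set (partial_homeo 'rV[R]_n N)) (f : X -> N).
Hypothesis (lt_mn : (m < n)%N).
Hypothesis cX : @second_countable X.
Hypothesis hX : hausdorff_space X.
Hypothesis hN : hausdorff_space N.
Hypothesis D_coord : forall c, D c -> DC_coord c.
Hypothesis atlasA : analytic_atlas A.
Hypothesis f_imm : DC_immersion D A f.

Lemma initial_lift (Gamma : R -> N) eps : analytic_curve A Gamma ->
  0 < eps < 1 -> (forall t, 0 <= t < eps -> range f (Gamma t)) ->
  exists a t0 b s,
    [/\ a < t0 < b, b <= 1, 0 <= a, t0 < eps & is_lift f Gamma a b s].
Proof.
move=> cG /andP[eps0 eps1] fG.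
have /choice[q qE] t : exists q, 0 <= t < eps -> f q = Gamma t.
  have [/fG[q _ fq]|_] := boolP (0 <= t < eps); first by exists q.
  (* Outside [[0, eps)] any point will do; one over [Gamma 0] is taken. *)
  have [q _ _] := fG 0 ltac:(rewrite lexx eps0 //).
  by exists q.
have [t0 /andP[t00 t0e] acc] := curve_accumulation q cX eps0.
have t01 : 0 < t0 < 1 by rewrite t00 (lt_trans t0e).
have ft0 : f (q t0) = Gamma t0 by apply: qE; rewrite t0e ltW.
have [V d Vt d0|s [V _ /nbhs_ballP[e /= e0 sE]]] :=
    local_lift lt_mn D_coord atlasA f_imm cG t01 ft0.
  have [t [td /andP[t0' te] Vq]] := acc V d Vt d0.
  exists t, (q t); split=> //; first by rewrite ltW // ltW // (lt_trans te).
  by apply: qE; rewrite ltW.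
(* The interval is cut to stay within [[0, 1]], where [Gamma] is controlled. *)
exists (Num.max 0 (t0 - e)), t0, (Num.min 1 (t0 + e)), s.
case/andP: t01 => _ t01.
rewrite gt_max lt_min t00 t01 ltrBlDr ltrDl e0 ge_min lexx le_max lexx.
split=> // t.
rewrite gt_max lt_min => /andP[/andP[_ t1] /andP[_ t2]].
have [|? ? _] := sE t; last by split.
by rewrite /ball /= ltr_norml; apply/andP; split; lra.
Qed.

Lemma arc_proper_complete : [set: X] !=set0 ->
  arc_proper A f -> analytically_complete A (range f).
Proof.
move=> [x0 _] ap; split; first by exists (f x0), x0.
move=> Gamma cG [eps eps01 fG].
have [a [t0 [b [s0 [at0b b1 a0 t0e ls0]]]]] := initial_lift cG eps01 fG.
have inj := locally_injective lt_mn D_coord f_imm.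
have [T [s [/andP[t0T T1] ls Tmax]]] := lift_maximal hX inj at0b b1 ls0.
have /andP[at0 _] := at0b.
have t00 : 0 <= t0 by rewrite ltW // (le_lt_trans a0).
(* Starting at [t0], inside the open interval of the lift, makes the rescaled lift continuous on all
   of [[0, 1)]. *)
have param u : 0 <= u < 1 -> t0 <= t0 + u * (T - t0) < T.
  by move=> /andP[u0 u1]; apply/andP; split; nra.
have [||u [u01 u1 [p up]]] := ap (fun u => s (t0 + u * (T - t0))).
- apply: continuous_in_subspaceT => u; rewrite inE => /= /param /andP[tu uT].
  have [|cs _] := ls (t0 + u * (T - t0)); first by rewrite (lt_le_trans at0).
  have ac : {for u, continuous (fun u : R => t0 + u * (T - t0))}.
    apply: cvgD; first exact: cvg_cst.
    by apply: cvgM; [exact: cvg_id | exact: cvg_cst].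
  exact: (continuous_comp ac cs).
- exists (fun u => Gamma (t0 + u * (T - t0))).
    by apply: analytic_curve_affine => //; exact: ltW.
  move=> u /param /andP[tu uT].
  by have [|_ ->] := ls (t0 + u * (T - t0)); rewrite // (lt_le_trans at0).
pose v k := t0 + u k * (T - t0).
have vT : v @ \oo --> T.
  rewrite [X in _ --> X](_ : T = t0 + 1 * (T - t0)); last by ring.
  by apply: cvgD; [exact: cvg_cst | apply: cvgM => //; exact: cvg_cst].
have v01 k : t0 <= v k < T by exact: param.
have fv k : f (s (v k)) = Gamma (v k).
  have /andP[tv vT'] := v01 k.
  by have [|_ ->] := ls (v k); rewrite // (lt_le_trans at0).
have T01 : 0 <= T <= 1 by rewrite T1 ltW // (le_lt_trans t00).
have fp : f p = Gamma T.
  have l1 : (fun k => f (s (v k))) @ \oo --> f p.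
    by move=> V /(immersion_continuous D_coord f_imm) /up.
  have l2 : (fun k => f (s (v k))) @ \oo --> Gamma T.
    move=> V /(curve_continuous atlasA cG T01) VG.
    have VG' : \forall t \near T, 0 <= t <= 1 -> V (Gamma t) by exact: VG.
    have := vT _ VG'; rewrite nbhs_simpl /= => Vv.
    apply: filterS Vv => k Vk; rewrite /= fv; apply: Vk.
    have /andP[tv vT'] := v01 k.
    by rewrite (le_trans t00) //= ltW // (lt_le_trans vT').
  exact: (cvg_unique hN l1 l2).
move=> t /andP[t0' t1'].
have [te|et] := ltP t eps; first by apply: fG; rewrite t0'.
have [T1'|T1'] := eqVneq T 1.
  have [->|tn1] := eqVneq t 1; first by exists p; rewrite // fp T1'.
  have [|_ <-] := ls t; last by exists (s t).
  rewrite (lt_trans at0) ?(lt_le_trans t0e) //= T1' lt_neqAle tn1 //.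
(* If [T < 1], the points [(v k, s (v k))] with [v k < T] supply the accumulation at [(T, p)]
   required by [local_lift], and the resulting lift around [T] contradicts maximality. *)
exfalso.
have {}T01 : 0 < T < 1 by rewrite (le_lt_trans t00) //= lt_neqAle T1'.
have [V d Vp d0|s2 [V oV /nbhs_ballP[e /= e0 s2E]]] :=
    local_lift lt_mn D_coord atlasA f_imm cG T01 fp.
  have nV : \forall k \near \oo, V (s (v k)) by exact: up.
  have nd : \forall k \near \oo, `|T - v k| < d.
    by move/cvgrPdist_lt : vT; apply.
  near \oo => k.
  exists (v k), (s (v k)); split; rewrite ?fv //.
  + have /andP[_ vT'] := v01 k.
    rewrite normr_gt0 subr_eq0 lt_eqF //= distrC.
    by near: k.
  + have /andP[tv vT'] := v01 k.
    by rewrite (le_trans t00) //= ltW // (lt_le_trans vT').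
  + by near: k.
have nV : \forall k \near \oo, V (s (v k)) by exact: (up _ (open_nbhs_nbhs oV)).
(* The bound [1 - T] keeps the extended lift from passing 1, as [Tmax] compares only right ends
   [b <= 1]. *)
have dd : 0 < Num.min e (1 - T).
  by case/andP: T01 => _ ?; rewrite lt_min e0 subr_gt0.
have nd : \forall k \near \oo, `|T - v k| < Num.min e (1 - T).
  by move/cvgrPdist_lt : vT; apply.
near \oo => k.
have /andP[tv vTk] := v01 k.
have kV : V (s (v k)) by near: k.
have kd : `|T - v k| < Num.min e (1 - T) by near: k.
have ke : `|T - v k| < e by move: kd; rewrite lt_min => /andP[].
have avT : a < v k < T by rewrite vTk (lt_le_trans at0).
have dv : T - Num.min e (1 - T) < v k.
  by move: kd; rewrite ltr_norml => /andP[]; lra.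
have ls2 : is_lift f Gamma (T - Num.min e (1 - T)) (T + Num.min e (1 - T)) s2.
  move=> r /andP[r1 r2]; have [|? ? _] := s2E r; last by split.
  have : Num.min e (1 - T) <= e by rewrite ge_min lexx.
  by rewrite /ball /= ltr_norml => le; apply/andP; split; lra.
(* The last clause of [local_lift] joins the two lifts: [s (v k)] lies in [V] over [Gamma (v k)], so
   it is the value of [s2] there. *)
have s12 : s (v k) = s2 (v k) by have [_ _] := s2E _ ke; apply.
have [s3 ls3 s3E] := lift_glue hX inj ls ls2 avT dv s12.
have : T + Num.min e (1 - T) <= T.
  apply: (Tmax _ s3) => //; last exact: s3E.
  have : Num.min e (1 - T) <= 1 - T by rewrite ge_min lexx orbT.
  lra.
by rewrite gerDl leNgt dd.
Unshelve. all: end_near. Qed.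

(** The lift stays in the preimage of the compact set [Gamma([0, 1])], which is compact, so it has a
    cluster point as the parameter tends to 1 from the left. Second countability turns it into the
    limit of a sequence. *)
Lemma proper_arc_proper : proper_map f -> arc_proper A f.
Proof.
move=> pf s cs [Gamma cG Gs].
have cK : compact (Gamma @` `[0, 1]%classic).
  apply: continuous_compact; last exact: segment_compact.
  apply/subspace_continuousP => t; rewrite /= in_itv /= => t01.
  have := curve_continuous atlasA cG t01.
  by rewrite (_ : `[0, 1]%classic = [set t | 0 <= t <= 1]).
have near01 : \forall t \near (1 : R)^'-, 0 <= t < 1.
  near=> t; apply/andP; split; last by near: t; exact: nbhs_left_lt.
  by near: t; apply: nbhs_left_ge.
have [|p [_ clp]] := pf _ cK (s @ (1 : R)^'-) _.
  change (\forall t \near (1 : R)^'-, (Gamma @` `[0, 1]%classic) (f (s t))).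
  apply: filterS near01 => t /andP[t0 t1]; exists t.
    by rewrite /= in_itv /= t0 ltW.
  by rewrite Gs // t0.
have [U [Un UV]] := countable_nbhs_basis p cX.
have /choice[t tE] k : exists t,
    [/\ 0 <= t < 1, `|1 - t| < k.+1%:R^-1 & U k (s t)].
  have [|_ [[t [t01 tk] <-] Ut]] := clp
      (s @` [set t | 0 <= t < 1 /\ `|1 - t| < k.+1%:R^-1]) (U k) _ (Un k).
    change (\forall t \near (1 : R)^'-,
      (s @` [set t | 0 <= t < 1 /\ `|1 - t| < k.+1%:R^-1]) (s t)).
    near=> t; exists t => //; split; first by near: t.
    have /andP[_ t1] : 0 <= t < 1 by near: t.
    rewrite ger0_norm ?subr_ge0 ?(ltW t1) // ltrBlDr -ltrBlDl.
    by near: t; apply: nbhs_left_gt; rewrite ltrBlDr ltrDl invr_gt0.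
  by exists t.
exists t; split; first by move=> k; have [] := tE k.
  apply/cvgrPdist_lt => e e0; near=> k.
  have [_ tk _] := tE k; apply: lt_trans tk _; near: k.
  exact: (near_infty_natSinv_lt (PosNum e0)).
exists p => V /UV Vk; change (\forall k \near \oo, V (s (t k))).
by apply: filterS Vk => k; apply; have [] := tE k.
Unshelve. all: end_near. Qed.

End Completeness.

Theorem theorem3p10 (R : realType) (m n : nat) (X N : topologicalType)
    (D : set (partial_homeo 'rV[R]_(m + 1) X))
    (A : set (partial_homeo 'rV[R]_n N)) (f : X -> N)
    (m_ge2 : (2 <= m)%N) (lt_mn : (m < n)%N)
    (X_nonempty : [set: X] !=set0)
    (X_DC : analytic_DC_manifold D) (N_analytic : analytic_manifold A)
    (f_imm : DC_immersion D A f) :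
  (arc_proper A f -> analytically_complete A (range f)) /\
  (proper_map f -> analytically_complete A (range f)).
Proof.
have [[cX hX _] [D_coord _ _] _] := X_DC.
have [hN _ atlasA _] := N_analytic.
have arc := arc_proper_complete lt_mn cX hX hN D_coord atlasA f_imm X_nonempty.
split=> // pf; apply: arc.
exact: (proper_arc_proper cX atlasA pf).
Qed.
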